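(* For integers $0\le k\le n$, the number of edge-marked increasing ternary trees on the vertex set $[n]$ with $n-k$ marked edges (hence, when $n\ge1$, $k-1$ unmarked edges) is the second-order Stirling cycle number $\left[{n\atop k}\right]^{(2)}$.
   Context: A ternary tree is recursively defined as either empty, or a root together with an ordered list of three ternary subtrees (left, middle, right), each possibly empty. An edge is drawn from each vertex to the root of each of its nonempty subtrees, called a left, middle or right edge according to the subtree. An increasing ternary tree on the vertex set $[n]=\{1,\ldots,n\}$ is a ternary tree whose vertices are labeled bijectively by $[n]$ so that each vertex has a larger label than its parent (for $n=0$ the only one is the empty tree). An edge-marked increasing ternary tree is an increasing ternary tree in which each middle or right edge may be marked or unmarked; left edges are always unmarked. $\left[{n\atop k}\right]^{(2)}$ is the number of permutations of $[n+k]$ with exactly $k$ cycles, all of size $\ge 2$. *)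

(* Defs.v *)
From HB Require Import structures.
From mathcomp Require Import all_boot all_fingroup finmap.
From mathcomp Require Import classical_sets cardinality.

Set Implicit Arguments.
Unset Strict Implicit.
Unset Printing Implicit Defensive.

Local Open Scope fset_scope.
Local Open Scope classical_set_scope.

Inductive tree : Type :=
| Empty
| Node of nat & tree & tree & tree.

Inductive branch : Type := Left | Middle | Right.

Definition ord_of_branch (b : branch) : 'I_3 :=
  inord (match b with Left => 0 | Middle => 1 | Right => 2 end).

Definition branch_of_ord (i : 'I_3) : branch :=
  match val i with 0 => Left | 1 => Middle | _ => Right end.

Lemma ord_of_branchK : cancel ord_of_branch branch_of_ord.
Proof. by case; rewrite /branch_of_ord /= inordK. Qed.

HB.instance Definition _ := Countable.copy branch (can_type ord_of_branchK).

(* (p, b, c) is the b-edge from the vertex labeled p to its child labeled c *)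
Notation edge := (nat * branch * nat)%type.

Definition parent (e : edge) : nat := e.1.1.
Definition kind (e : edge) : branch := e.1.2.
Definition child (e : edge) : nat := e.2.

Fixpoint labels (t : tree) : seq nat :=
  if t is Node x l m r then x :: labels l ++ labels m ++ labels r else [::].

Definition root_edge (x : nat) (b : branch) (t : tree) : seq edge :=
  if t is Node y _ _ _ then [:: (x, b, y)] else [::].

Fixpoint edges (t : tree) : seq edge :=
  if t is Node x l m r then
    root_edge x Left l ++ root_edge x Middle m ++ root_edge x Right r
      ++ edges l ++ edges m ++ edges r
  else [::].

Definition increasing_tree (n : nat) (t : tree) : Prop :=
  perm_eq (labels t) (iota 1 n) /\
  {in edges t, forall e, parent e < child e}.

(* A tree together with its set of marked edges. Recording edges by the labels
   of their endpoints is unambiguous once the labels are distinct. *)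
Definition marked_tree : Type := tree * {fset edge}.

Definition edge_marked_tree (n : nat) (T : marked_tree) : Prop :=
  increasing_tree n T.1 /\
  {in T.2, forall e, e \in edges T.1 /\ kind e <> Left}.

Definition marked_edges (T : marked_tree) : {fset edge} := T.2.

Definition unmarked_edges (T : marked_tree) : {fset edge} :=
  ([fset e in edges T.1] `\` T.2)%fset.

Definition edge_marked_trees (n j : nat) : set marked_tree :=
  [set T | edge_marked_tree n T /\ #|` marked_edges T| = j].

(* The orbits of a permutation are its cycles, fixed points included. *)
Definition stirling_cycle2 (n k : nat) : nat :=
  #|[set s : 'S_(n + k) | (#|porbits s| == k) &&
      [forall C in porbits s, 2 <= #|C|] ]%SET|.

(* Main.v *)
(* Both sides are computed by inserting the largest (or a new) element.

   Grafting the leaf n+1 onto an increasing ternary tree on [n] with m middle or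
   right edges fills one of m+1 left slots or one of 2n-m other slots, so the
   number of increasing trees with m such edges follows the recurrence of the
   second-order Eulerian numbers. Choosing j marked edges among the m gives the
   count A(n,j) = sum_t C(m(t),j), and the pointwise identity
   (m+1) C(m,j) + (2n-m) C(m+1,j) = (2n+1-j) C(m+1,j) turns the grafting step into
   A(n+1,j) = (2n+1-j) (A(n,j-1) + A(n,j)).

   On the other side, inserting a new point into a cycle of a permutation of n+1
   points produces a derangement of n+2 points exactly when the permutation has no
   fixed point other than the one where the insertion takes place. Hence
   d(n+2,k+1) = (n+1) (d(n+1,k+1) + d(n,k)) for derangements with a given number of
   cycles, which is the same recurrence under j = n-k. *)
From HB Require Import structures.
Require Import Defs.
From mathcomp Require Import all_boot all_fingroup finmap zify.
From mathcomp Require Import classical_sets cardinality.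
(* [classical_sets] shadows the constructor [Empty]. *)
Import Defs.

Set Implicit Arguments.
Unset Strict Implicit.
Unset Printing Implicit Defensive.

(** * Derangements by number of cycles *)

Definition derangements (n k : nat) : nat :=
  #|[set s : 'S_n | (#|porbits s| == k) & [forall x, s x != x]]|%SET.

Lemma card_porbit_gt1 (T : finType) (s : {perm T}) (x : T) :
  (1 < #|porbit s x|) = (s x != x).
Proof.
apply/idP/idP=> [|sx_x].
  apply: contraTneq => sx_x; rewrite -leqNgt (_ : porbit s x = [set x]%SET) ?cards1 //.
  apply/setP=> y; rewrite inE; apply/porbitP/eqP=> [[i ->]|->]; last first.
    by exists 0; rewrite perm1.
  by elim: i => [|i IHi]; rewrite ?perm1 // expgSr permM IHi.
apply/card_gt1P; exists (s x), x; rewrite porbit_id sx_x; split=> //.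
by have := mem_porbit s 1 x; rewrite expg1.
Qed.

Lemma stirling_cycle2E n k : stirling_cycle2 n k = derangements (n + k) k.
Proof.
congr #|pred_of_set _|; apply/setP=> s; rewrite !inE; congr (_ && _).
apply/forall_inP/forallP=> [big x|der _ /imsetP[x _ ->]].
  by rewrite -card_porbit_gt1 big ?imset_f.
by rewrite card_porbit_gt1 der.
Qed.

(** * Adding a fixed point and inserting a point into a cycle *)

Lemma lift_perm_inj2 n (i : 'I_n.+1) :
  injective (fun p : 'I_n.+1 * 'S_n => lift_perm i p.1 p.2).
Proof.
move=> [j s] [j' s'] /= eq_ss'.
have eq_jj' : j = j' by rewrite -(lift_perm_id i j s) eq_ss' lift_perm_id.
rewrite -eq_jj' in eq_ss' *; congr (_, _); apply/permP=> x.
by apply: (@lift_inj _ j); rewrite -!(lift_perm_lift i) eq_ss'.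
Qed.

(** An injection between finite sets of equal size $(n+1)\cdot n! = (n+1)!$ is bijective. *)
Lemma lift_perm_surj n (i : 'I_n.+1) (L : 'S_n.+1) :
  exists s, L = lift_perm i (L i) s.
Proof.
have [|g _ gK] := inj_card_bij (@lift_perm_inj2 n i).
  by rewrite card_prod !card_Sn card_ord factS.
by exists (g L).2; rewrite -[in LHS](gK L) -[in L i](gK L) lift_perm_id.
Qed.

Lemma card_porbits_lift_perm n (i : 'I_n.+1) (s : 'S_n) :
  #|porbits (lift_perm i i s)| = #|porbits s|.+1.
Proof.
set L := lift_perm i i s.
have LX m x : (L ^+ m)%g (lift i x) = lift i ((s ^+ m)%g x).
  elim: m => [|m IHm]; first by rewrite !perm1.
  by rewrite !expgSr !permM IHm lift_perm_lift.
have LXi m : (L ^+ m)%g i = i.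
  by elim: m => [|m IHm]; rewrite ?perm1 // expgSr permM IHm lift_perm_id.
have orbL x : porbit L (lift i x) = [set lift i y | y in porbit s x]%SET.
  apply/setP=> y; apply/porbitP/imsetP=> [[m ->]|[_ /porbitP[m ->] ->]].
    by exists ((s ^+ m)%g x); rewrite ?mem_porbit ?LX.
  by exists m; rewrite LX.
have orbi : porbit L i = [set i]%SET.
  apply/setP=> y; rewrite inE; apply/porbitP/eqP=> [[m ->]|->]; first exact: LXi.
  by exists 0; rewrite LXi.
have -> : porbits L =
    ([set i]%SET |: [set [set lift i y | y in C]%SET | C : {set 'I_n} in porbits s])%SET.
  apply/setP=> C; rewrite !inE; apply/imsetP/orP=> [[x _ ->]|[/eqP->|]].
  - have [y ->|->] := unliftP i x; last by left; rewrite orbi.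
    by right; rewrite orbL; apply/imsetP; exists (porbit s y); rewrite ?imset_f.
  - by exists i; rewrite ?orbi.
  - case/imsetP=> _ /imsetP[x _ ->] ->; exists (lift i x) => //.
rewrite cardsU1 card_imset; last exact: imset_inj (@lift_inj _ i).
(* The orbit of [i] is a new one: lifted orbits avoid [i]. *)
case: imsetP => //= -[C _ eqC]; have: i \in [set i]%SET by rewrite inE.
by rewrite eqC => /imsetP[x _] /eqP; rewrite (negPf (neq_lift _ _)).
Qed.

(* Permutations compose left to right: the transposition acts first, so the new
   point [ord0] lands right after [i] in its cycle. *)
Definition insert_cycle n (i : 'I_n) (s : 'S_n) : 'S_n.+1 :=
  (tperm ord0 (lift ord0 i) * lift_perm ord0 ord0 s)%g.

Lemma insert_cycle_i n (i : 'I_n) s : insert_cycle i s (lift ord0 i) = ord0.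
Proof. by rewrite permM tpermR lift_perm_id. Qed.

Lemma insert_cycle_0 n (i : 'I_n) s : insert_cycle i s ord0 = lift ord0 (s i).
Proof. by rewrite permM tpermL lift_perm_lift. Qed.

Lemma insert_cycle_x n (i x : 'I_n) s :
  x != i -> insert_cycle i s (lift ord0 x) = lift ord0 (s x).
Proof.
move=> neq_xi; rewrite permM tpermD ?lift_perm_lift ?neq_lift //.
by rewrite (inj_eq lift_inj) eq_sym.
Qed.

(** The insertion place [i] is recovered as the preimage of [ord0]; cancelling the transposition
    then recovers [s]. *)
Lemma insert_cycle_inj n :
  injective (fun p : 'I_n * 'S_n => insert_cycle p.1 p.2).
Proof.
move=> [i s] [i' s'] /= eq_ss'.
have eq_ii' : i = i'.
  apply: (@lift_inj _ ord0); apply: (@perm_inj _ (insert_cycle i s)).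
  by rewrite [in RHS]eq_ss' !insert_cycle_i.
rewrite -eq_ii' in eq_ss' *; move/mulgI: eq_ss' => eq_ss'.
by have [->] := @lift_perm_inj2 _ ord0 (ord0, s) (ord0, s') eq_ss'.
Qed.

Lemma insert_cycle_surj n (s : 'S_n.+1) :
  s ord0 != ord0 -> exists i t, s = insert_cycle i t.
Proof.
move=> s0; have [i def_i|s'0] := unliftP ord0 ((s^-1)%g ord0); last first.
  by rewrite -{1}s'0 permKV eqxx in s0.
have [t def_t] := lift_perm_surj ord0 (tperm ord0 (lift ord0 i) * s)%g.
exists i, t; rewrite /insert_cycle.
have <- : (tperm ord0 (lift ord0 i) * s)%g = lift_perm ord0 ord0 t.
  by rewrite [LHS]def_t permM tpermL -def_i permKV.
by rewrite mulgA tperm2 mul1g.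
Qed.

(** Lifting adds the cycle of [ord0], and the transposition, joining points of distinct cycles,
    merges it into the cycle of [i]. *)
Lemma card_porbits_insert_cycle n (i : 'I_n) (s : 'S_n) :
  #|porbits (insert_cycle i s)| = #|porbits s|.
Proof.
have := porbits_mul_tperm (lift_perm ord0 ord0 s) ord0 (lift ord0 i).
rewrite /= card_porbits_lift_perm porbit_sym.
suff /negPf-> : lift ord0 i \notin porbit (lift_perm ord0 ord0 s) ord0.
  by rewrite addn1 addn2 => -[].
apply/porbitP=> -[m]; suff -> : (lift_perm ord0 ord0 s ^+ m)%g ord0 = ord0.
  by move/eqP; rewrite eq_sym (negPf (neq_lift _ _)).
by elim: m => [|m IHm]; rewrite ?perm1 // expgSr permM IHm lift_perm_id.
Qed.

Lemma insert_cycle_derangement n (i : 'I_n) (s : 'S_n) :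
  [forall x, insert_cycle i s x != x] = [forall (x | x != i), s x != x].
Proof.
apply/forallP/forall_inP=> der x => [neq_xi|].
  by have := der (lift ord0 x); rewrite insert_cycle_x // (inj_eq lift_inj).
have [{}x ->|->] := unliftP ord0 x; last first.
  by rewrite insert_cycle_0 eq_sym neq_lift.
have [->|neq_xi] := eqVneq x i; first by rewrite insert_cycle_i neq_lift.
by rewrite insert_cycle_x // (inj_eq lift_inj) der.
Qed.

(** Deleting the fixed point [i] leaves a derangement with one cycle fewer; [lift_perm i i] is the
    inverse. *)
Lemma card_one_fixed_point n k (i : 'I_n.+1) :
  #|[set s : 'S_n.+1 | [&& #|porbits s| == k.+1, s i == i &
       [forall (x | x != i), s x != x]]]|%SET = derangements n k.
Proof.
have inj_lift : injective (@lift_perm n i i).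
  by move=> s t eq_st; have [->] := @lift_perm_inj2 n i (i, s) (i, t) eq_st.
rewrite /derangements -(card_imset _ inj_lift); apply: eq_card => s; rewrite !inE.
apply/and3P/imsetP=> [[/eqP cyc /eqP si /forall_inP der]|[t + ->]]; last first.
  rewrite inE => /andP[/eqP cyc /forallP der].
  rewrite card_porbits_lift_perm cyc lift_perm_id !eqxx; split=> //.
  apply/forall_inP=> x; have [{}x -> _|->] := unliftP i x; last by rewrite eqxx.
  by rewrite lift_perm_lift (inj_eq lift_inj).
have [t def_s] := lift_perm_surj i s; rewrite si in def_s; exists t => //.
rewrite inE -eqSS -(card_porbits_lift_perm i) -def_s cyc eqxx.
apply/forallP=> x; have := der (lift i x); rewrite eq_sym neq_lift => /(_ isT).
by rewrite def_s lift_perm_lift (inj_eq lift_inj).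
Qed.

Lemma derangementsS n k :
  derangements n.+2 k.+1 = n.+1 * (derangements n.+1 k.+1 + derangements n k).
Proof.
pose P (p : 'I_n.+1 * 'S_n.+1) :=
  (#|porbits p.2| == k.+1) && [forall (x | x != p.1), p.2 x != x].
have -> : derangements n.+2 k.+1 = #|[set p | P p]%SET|.
  rewrite {1}/derangements.
  rewrite -(card_imset _ (@insert_cycle_inj n.+1)); apply: eq_card => s.
  rewrite inE; apply/andP/imsetP=> [[cyc der]|[[i t] + ->]]; last first.
    by rewrite inE card_porbits_insert_cycle insert_cycle_derangement => /andP.
  have [i [t def_s]] := insert_cycle_surj (forallP der ord0).
  exists (i, t); rewrite // inE /P /= -insert_cycle_derangement -def_s der.
  by rewrite -(card_porbits_insert_cycle i) -def_s cyc.
rewrite -sum1dep_card -(pair_big_dep xpredT (fun i s => P (i, s)) (fun _ _ => 1)) /=.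
rewrite (eq_bigr (fun=> derangements n.+1 k.+1 + derangements n k)); last first.
  (* For given [i], the permutations moving [i] are derangements, and in the others [i] is the only
     fixed point. *)
  move=> i _; rewrite sum1dep_card -(cardsID [set s : 'S_n.+1 | s i == i]%SET) addnC.
  rewrite -(card_one_fixed_point k i); congr (_ + _); apply: eq_card => s.
    rewrite !inE /P /= andbCA; congr (_ && _).
    apply/andP/forallP=> [[si /forall_inP der] x|der].
      by have [->|] := eqVneq x i; last exact: der.
    by split=> //; apply/forall_inP=> x _.
  by rewrite !inE /P /= -andbA; congr (_ && _); rewrite andbC.
by rewrite sum_nat_const card_ord.
Qed.

(** * Increasing trees and leaf insertion *)

Fixpoint tree_encode (t : tree) : GenTree.tree nat :=
  if t is Node x l m r then
    GenTree.Node 0 [:: GenTree.Leaf x; tree_encode l; tree_encode m; tree_encode r]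
  else GenTree.Leaf 0.

Fixpoint tree_decode (g : GenTree.tree nat) : tree :=
  if g is GenTree.Node _ [:: GenTree.Leaf x; l; m; r] then
    Node x (tree_decode l) (tree_decode m) (tree_decode r)
  else Empty.

Lemma tree_encodeK : cancel tree_encode tree_decode.
Proof. by elim=> //= x l -> m -> r ->. Qed.

HB.instance Definition _ := Countable.copy tree (can_type tree_encodeK).

Fixpoint grafts (x : nat) (t : tree) : seq tree :=
  if t is Node y l m r then
    [seq Node y l' m r | l' <- grafts x l] ++
    [seq Node y l m' r | m' <- grafts x m] ++
    [seq Node y l m r' | r' <- grafts x r]
  else [:: Node x Empty Empty Empty].

(** The whole subtree at [x] is cut off. It undoes a grafting because a grafted [x] is a leaf. *)
Fixpoint prune (x : nat) (t : tree) : tree :=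
  if t is Node y l m r then
    if y == x then Empty else Node y (prune x l) (prune x m) (prune x r)
  else Empty.

Lemma grafts_NodeP x y l m r t :
  reflect [\/ exists2 l', l' \in grafts x l & t = Node y l' m r,
              exists2 m', m' \in grafts x m & t = Node y l m' r
            | exists2 r', r' \in grafts x r & t = Node y l m r']
          (t \in grafts x (Node y l m r)).
Proof.
rewrite /= !mem_cat; apply: (iffP or3P) => -[] /mapP;
  by [constructor 1 | constructor 2 | constructor 3].
Qed.

Lemma perm_labels_grafts x t t' :
  t' \in grafts x t -> perm_eq (labels t') (x :: labels t).
Proof.
elim: t t' => [|y l IHl m IHm r IHr] t'; first by rewrite inE => /eqP->.
case/grafts_NodeP=> -[u /[dup] ut +] ->; [move/IHl|move/IHm|move/IHr] => /seq.permP eq_u;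
  by apply/seq.permP=> p; have := eq_u p; rewrite /= !count_cat /=; lia.
Qed.

Lemma mem_labels_grafts x t t' : t' \in grafts x t -> x \in labels t'.
Proof. by move/perm_labels_grafts/perm_mem->; rewrite mem_head. Qed.

(* Prepending the edge [(y, b, _)] to the root avoids a special case for grafting
   onto the empty tree. *)
Definition planted_edges (y : nat) (b : branch) (t : tree) : seq edge :=
  root_edge y b t ++ edges t.

Lemma perm_planted_grafts x y b t t' : t' \in grafts x t ->
  exists e, [/\ perm_eq (planted_edges y b t') (e :: planted_edges y b t),
    child e = x & parent e \in y :: labels t].
Proof.
rewrite /planted_edges; elim: t t' y b => [|z l IHl m IHm r IHr] t' y b.
  by rewrite inE => /eqP->; exists (y, b, x); rewrite mem_head.
case/grafts_NodeP=> -[u + ->];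
  [move/(IHl _ z Left)|move/(IHm _ z Middle)|move/(IHr _ z Right)] => -[e [/seq.permP eq_u ex ein]];
  (exists e; split=> //; last first).
1,3,5: by move: ein; rewrite /= !inE !mem_cat => /orP[] -> /=; rewrite ?orbT.
all: by apply/seq.permP=> p; have := eq_u p; rewrite /= !count_cat /=; lia.
Qed.

(** Planting gives the root an incoming edge too, so edges and vertices correspond; this yields both
    the number of edges and their distinctness. *)
Lemma perm_labels_child y b t :
  perm_eq (labels t) [seq child e | e <- planted_edges y b t].
Proof.
rewrite /planted_edges; elim: t y b => [|x l IHl m IHm r IHr] y b //.
apply/seq.permP=> p; have /seq.permP/(_ p) := IHl x Left; have /seq.permP/(_ p) := IHm x Middle.
have /seq.permP/(_ p) := IHr x Right.
by rewrite /= !map_cat !count_cat /=; lia.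
Qed.

Lemma size_labels y b t : size (labels t) = size (planted_edges y b t).
Proof. by rewrite (perm_size (perm_labels_child y b t)) size_map. Qed.

Lemma uniq_edges t : uniq (labels t) -> uniq (edges t).
Proof.
rewrite (perm_uniq (perm_labels_child 0 Left t)) => /map_uniq.
by rewrite cat_uniq => /and3P[].
Qed.

Lemma prune_id x t : x \notin labels t -> prune x t = t.
Proof.
elim: t => //= y l IHl m IHm r IHr; rewrite inE !mem_cat eq_sym !negb_or.
by case/and4P=> /negPf-> /IHl-> /IHm-> /IHr->.
Qed.

Lemma prune_grafts x t t' : x \notin labels t -> t' \in grafts x t -> prune x t' = t.
Proof.
elim: t t' => [|y l IHl m IHm r IHr] t'; first by rewrite /= inE => _ /eqP-> /=; rewrite eqxx.
move=> + /grafts_NodeP t'P.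
rewrite /= inE !mem_cat eq_sym !negb_or => /and4P[/negPf y_x xl xm xr].
case: t'P => -[u ut ->] /=; rewrite y_x.
- by rewrite (IHl u) // (prune_id xm) (prune_id xr).
- by rewrite (IHm u) // (prune_id xl) (prune_id xr).
- by rewrite (IHr u) // (prune_id xl) (prune_id xm).
Qed.

(** A tree arising from grafts into two different subtrees would leave one of them both unchanged
    and containing [x]. *)
Lemma uniq_grafts x t : x \notin labels t -> uniq (grafts x t).
Proof.
have subF (u : tree) : x \notin labels u -> u \notin grafts x u.
  by apply: contra => /mem_labels_grafts.
elim: t => //= y l IHl m IHm r IHr; rewrite inE !mem_cat !negb_or.
case/and4P=> _ xl xm xr; rewrite !cat_uniq !map_inj_uniq ?IHl ?IHm ?IHr //=;
  try by move=> ? ? [].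
rewrite !andbT; apply/andP; split; apply/hasPn=> t; last first.
  case/mapP=> r' r'P ->; apply/mapP=> -[m' m'P [_ def_r']].
  by have := subF r xr; rewrite -{1}def_r' r'P.
rewrite mem_cat => /orP[] /mapP[u uP ->]; apply/mapP=> -[l' l'P [def_l _]];
  by have := subF l xl; rewrite {1}def_l l'P.
Qed.

Definition edge_increasing (e : edge) : bool := parent e < child e.

(** The largest label of an increasing tree sits at a leaf, so pruning there removes a single
    vertex. *)
Lemma grafts_prune x t : uniq (labels t) -> x \in labels t ->
  all (fun y => y <= x) (labels t) -> all edge_increasing (edges t) ->
  t \in grafts x (prune x t).
Proof.
elim: t => // y l IHl m IHm r IHr /=.
rewrite inE !mem_cat !cat_uniq !all_cat !negb_or -!andbA eq_sym.
case/and5P=> _ _ _ ul /and4P[/hasPn dl um /hasPn dm ur].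
move=> xt /and4P[_ lex_l lex_m lex_r] /and5P[yl ym yr il /andP[im ir]].
case: (eqVneq y x) xt => [eq_yx _|neq_yx /=].
  have nochild b (u : tree) : all edge_increasing (root_edge y b u) ->
      all (fun z => z <= x) (labels u) -> u = Empty.
    case: u => //= z u1 u2 u3; rewrite /edge_increasing eq_yx /parent /child /=.
    by case/andP=> xz _ /andP[zx _]; rewrite ltnNge zx in xz.
  rewrite (nochild Left l) // (nochild Middle m) // (nochild Right r) //.
  by rewrite eq_yx mem_head.
(* Labels being distinct, [x] lies in one subtree only, and pruning leaves the other two
   unchanged. *)
have xdl : x \in labels l -> x \notin labels m ++ labels r.
  by move=> xl; apply/negP=> /dl /=; rewrite xl.
have xdm : x \in labels m -> x \notin labels r.
  by move=> xm; apply/negP=> /dm /=; rewrite xm.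
case/or3P=> xu; apply/grafts_NodeP.
- move: (xdl xu); rewrite mem_cat negb_or => /andP[xm xr].
  rewrite (prune_id xm) (prune_id xr); constructor 1; exists l => //.
  exact: IHl.
- have xl : x \notin labels l by apply: contraL xu => /xdl; rewrite mem_cat negb_or => /andP[].
  rewrite (prune_id xl) (prune_id (xdm xu)); constructor 2; exists m => //.
  exact: IHm.
- have xl : x \notin labels l.
    by apply: contraL xu => /xdl; rewrite mem_cat negb_or => /andP[].
  have xm : x \notin labels m by apply: contraL xu => /xdm.
  rewrite (prune_id xl) (prune_id xm); constructor 3; exists r => //.
  exact: IHr.
Qed.

(** * Middle and right edges under grafting *)

Definition markable (e : edge) : bool := kind e != Left.
Definition nmark (t : tree) : nat := count markable (edges t).

Lemma count_markable_root_edge x b t :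
  count markable (root_edge x b t) = (b != Left) && (t != Empty).
Proof. by case: t => [|y l m r] /=; rewrite ?andbF // andbT addn0. Qed.

Lemma nmark_Node x l m r :
  nmark (Node x l m r) = nmark l + nmark m + nmark r + (m != Empty) + (r != Empty).
Proof.
rewrite /nmark [edges _]/= !count_cat !count_markable_root_edge eqxx.
have -> : Middle != Left by apply/eqP.
have -> : Right != Left by apply/eqP.
rewrite !andTb [_ && _]/=; move: (m != Empty : nat) (r != Empty : nat) => a b.
by lia.
Qed.

Lemma leq_nmark t : nmark t <= size (labels t).
Proof.
rewrite (size_labels 0 Left) /planted_edges size_cat.
by rewrite (leq_trans (count_size _ _)) ?leq_addl.
Qed.

Lemma grafts_neq0 x t t' : t' \in grafts x t -> t' != Empty.
Proof. by move/mem_labels_grafts; case: t'. Qed.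

(** With $s\ge1$ vertices and $m$ middle or right edges there are $s-1-m$ left edges, hence $m+1$
    free left slots and $2s-m$ other ones. The empty tree counts as one left slot. An arbitrary [F]
    can absorb the shifts that occur in the induction. *)
Definition sum_grafts_spec x t := forall F : nat -> nat,
  \sum_(t' <- grafts x t) F (nmark t') =
  (nmark t).+1 * F (nmark t) + ((size (labels t)).*2 - nmark t) * F (nmark t).+1.

(** Here [t] is a middle or right subtree, [c] the contribution of the rest and [N] that of the
    whole tree. If [t] is empty, its only graft creates a new markable edge, which raises the count
    to [N.+1]. *)
Lemma sum_grafts_markable x t c N (F : nat -> nat) :
  sum_grafts_spec x t -> N = nmark t + (t != Empty) + c ->
  \sum_(t' <- grafts x t) F (nmark t' + (t' != Empty) + c) =
  (t != Empty) * (nmark t).+1 * F N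
    + ((size (labels t)).*2 - nmark t + (t == Empty)) * F N.+1.
Proof.
move=> IHt ->.
rewrite (eq_big_seq (fun t' => F (nmark t' + 1 + c))) => [|t' /grafts_neq0-> //].
rewrite (IHt (fun a => F (a + 1 + c))).
by have [->|t0] := eqVneq t Empty; rewrite ?mul0n ?mul1n ?addn0 ?addn1.
Qed.

Lemma sum_grafts x t : sum_grafts_spec x t.
Proof.
elim: t => [|y l IHl m IHm r IHr] F; first by rewrite big_seq1 addn0 mul1n.
have NE := nmark_Node y l m r; set N := nmark (Node y l m r) in NE *.
have -> : \sum_(t' <- grafts x (Node y l m r)) F (nmark t') =
    \sum_(l' <- grafts x l) F (nmark l' + (N - nmark l))
    + (\sum_(m' <- grafts x m)
         F (nmark m' + (m' != Empty) + (nmark l + nmark r + (r != Empty)))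
       + \sum_(r' <- grafts x r)
           F (nmark r' + (r' != Empty) + (nmark l + nmark m + (m != Empty)))).
  rewrite [grafts _ _]/= !big_cat !big_map /=.
  by congr (_ + (_ + _)); apply: eq_bigr => u _; rewrite nmark_Node; congr F; lia.
clearbody N.
(* The edge to the left subtree is never markable, so the induction hypothesis applies there even
   when [l] is empty. *)
rewrite (IHl (fun a => F (a + _))) addSn subnKC; last lia.
rewrite (sum_grafts_markable (N := N) _ IHm) ?(sum_grafts_markable (N := N) _ IHr); try lia.
rewrite /= !size_cat.
have := (leq_nmark l, leq_nmark m, leq_nmark r).
case=> [[le_l le_m] le_r].
(* Middle and right slots: those inside the subtrees, and one for each empty [m] or [r]. *)
have -> : (size (labels l) + (size (labels m) + size (labels r))).+1.*2 - N =
    (size (labels l)).*2 - nmark l + ((size (labels m)).*2 - nmark m + (m == Empty))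
     + ((size (labels r)).*2 - nmark r + (r == Empty)).
  by rewrite NE; case: (m == _); case: (r == _) => /=; lia.
(* Left slots: an empty [l] provides one, whereas an empty [m] or [r] provides none. *)
rewrite [X in _ = X * F N + _](_ : N.+1 =
    (nmark l).+1 + (m != Empty) * (nmark m).+1 + (r != Empty) * (nmark r).+1); last first.
  have nmark0 : nmark Empty = 0 by [].
  rewrite NE; have [->|_] := eqVneq m Empty; have [->|_] := eqVneq r Empty;
    rewrite ?nmark0 /=; lia.
by rewrite !mulnDl; lia.
Qed.

(** * Enumeration of increasing trees *)

Fixpoint increasing_trees (n : nat) : seq tree :=
  if n is n'.+1 then [seq t' | t <- increasing_trees n', t' <- grafts n t] else [:: Empty].

(** The label 0 serves as a virtual parent of the root, below all of $[n]$. *)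
Lemma planted_increasing n b t : increasing_tree n t ->
  {in planted_edges 0 b t, forall e, parent e < child e}.
Proof.
move=> [lab inc] e; rewrite mem_cat => /orP[|/inc //].
case: t lab {inc} => //= y l m r /perm_mem/(_ y).
by rewrite mem_head inE mem_iota => /esym/andP[y_gt0 _] /eqP->.
Qed.

Lemma mem_increasing_trees n t :
  t \in increasing_trees n <-> increasing_tree n t.
Proof.
elim: n t => [|n IHn] t.
  rewrite inE; split=> [/eqP->|[/perm_nilP]]; last by case: t.
  by split.
have iotaS : perm_eq (n.+1 :: iota 1 n) (iota 1 n.+1).
  by rewrite -(addn1 n) iotaD perm_sym perm_catC add1n addn1.
split=> [/allpairsPdep[u [t' [/IHn u_inc t'_in ->{t}]]]|[lab inc]].
  have [lab _] := u_inc; split.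
    rewrite (permPl (perm_labels_grafts t'_in)) -(permPr iotaS) perm_cons //.
  move=> e e_in; have [e' [/perm_mem eqE ce' pe']] := perm_planted_grafts 0 Left t'_in.
  have: e \in planted_edges 0 Left t' by rewrite mem_cat e_in orbT.
  rewrite eqE inE => /predU1P[->|]; last exact: (planted_increasing u_inc).
  rewrite ce' ltnS; move: pe'; rewrite inE (perm_mem lab) mem_iota.
  by case/predU1P=> [->|/andP[]] //; rewrite add1n.
have t_in : t \in grafts n.+1 (prune n.+1 t).
  apply: grafts_prune; rewrite ?(perm_uniq lab) ?iota_uniq //.
  - by rewrite (perm_mem lab) mem_iota add1n !ltnS leqnn.
  - by apply/allP=> y; rewrite (perm_mem lab) mem_iota add1n ltnS => /andP[].
  - exact/allP.
apply/allpairsPdep; exists (prune n.+1 t), t; split=> //; apply/IHn; split.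
  by rewrite -(perm_cons n.+1) -(permPl (perm_labels_grafts t_in)) (permPr iotaS).
move=> e e_in; have [e' [/perm_mem eqE _ _]] := perm_planted_grafts 0 Left t_in.
apply: (@planted_increasing n.+1 Left t); first by split.
by rewrite eqE inE mem_cat e_in !orbT.
Qed.

Lemma notin_labels_increasing n t : t \in increasing_trees n -> n.+1 \notin labels t.
Proof.
by move/mem_increasing_trees=> [lab _]; rewrite (perm_mem lab) mem_iota add1n ltnn andbF.
Qed.

(** Pruning [n.+1] recovers the tree that was grafted onto, so no tree arises from two different
    ones. *)
Lemma increasing_trees_uniq n : uniq (increasing_trees n).
Proof.
elim: n => // n IHn; apply: allpairs_uniq_dep => // [t /notin_labels_increasing|].
  exact: uniq_grafts.
move=> _ _ /allpairsPdep[t [t' [tP t'P ->]]] /allpairsPdep[u [u' [uP u'P ->]]] /= eq_tu.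
rewrite -eq_tu in u'P *.
rewrite -(prune_grafts (notin_labels_increasing tP) t'P).
by rewrite -{1}(prune_grafts (notin_labels_increasing uP) u'P).
Qed.

Lemma size_labels_increasing n t : t \in increasing_trees n -> size (labels t) = n.
Proof. by move/mem_increasing_trees=> [/perm_size]; rewrite size_iota. Qed.

Lemma size_edges n t : increasing_tree n t -> size (edges t) = n.-1.
Proof.
move=> [/perm_size + _]; rewrite size_iota (size_labels 0 Left) size_cat => <-.
by case: t.
Qed.

(** * The common recurrence *)

Lemma sum_mul_bin m s j : m <= s.*2 ->
  m.+1 * 'C(m, j) + (s.*2 - m) * 'C(m.+1, j) = (s.*2.+1 - j) * 'C(m.+1, j).
Proof.
move=> le_m; have [le_j|lt_j] := leqP j m.+1; last first.
  by rewrite !bin_small ?muln0 // ltnW.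
have -> : m.+1 * 'C(m, j) = (m.+1 - j) * 'C(m.+1, j) by rewrite -mul_bin_down.
by rewrite -mulnDl; congr (_ * _); lia.
Qed.

Definition marked_count (n j : nat) : nat :=
  \sum_(t <- increasing_trees n) 'C(nmark t, j).

Lemma marked_countS n j : marked_count n.+1 j =
  (n.*2.+1 - j) * \sum_(t <- increasing_trees n) 'C((nmark t).+1, j).
Proof.
rewrite /marked_count big_allpairs_dep big_distrr; apply: eq_big_seq => t tP /=.
rewrite (sum_grafts _ _ (fun a => 'C(a, j))) (size_labels_increasing tP) sum_mul_bin //.
by rewrite (leq_trans (leq_nmark t)) // (size_labels_increasing tP) -addnn leq_addr.
Qed.

Lemma marked_countS0 n : marked_count n.+1 0 = n.*2.+1 * marked_count n 0.
Proof. by rewrite marked_countS; congr (_ * _); apply: eq_bigr => t _; rewrite !bin0. Qed.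

Lemma marked_countSS n j :
  marked_count n.+1 j.+1 = (n.*2 - j) * (marked_count n j + marked_count n j.+1).
Proof.
by rewrite marked_countS -big_split /=; congr (_ * _); apply: eq_bigr => t _; rewrite addnC.
Qed.

(** There are only $n-1$ edges to mark. The case $n=0$, $j=0$ is a true exception: the empty tree
    counts 1. *)
Lemma marked_count_small n j : 0 < n -> n <= j -> marked_count n j = 0.
Proof.
move=> n_gt0 le_nj; rewrite /marked_count big_seq big1 // => t /mem_increasing_trees tP.
rewrite bin_small // (leq_trans _ le_nj) // (leq_ltn_trans (count_size _ _)) //.
by rewrite (size_edges tP) prednK.
Qed.

Lemma card_porbits_ord0 (s : 'S_0) : #|porbits s| = 0.
Proof.
by apply/eqP; rewrite -leqn0 (leq_trans (leq_imset_card _ _)) ?card_ord.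
Qed.

(** Cycles of size at least 2 need $2k$ points; the recurrence gives this by induction. *)
Lemma derangements_small n k : n < k.*2 -> derangements n k = 0.
Proof.
elim/ltn_ind: n k => -[|[|n]] IHn [|k] // lt_nk.
- apply: eq_card0 => s; rewrite !inE.
  by rewrite card_porbits_ord0.
- apply: eq_card0 => s; rewrite !inE; apply/andP=> -[_ /forallP/(_ ord0)].
  by rewrite (ord1 (s _)).
by rewrite derangementsS !IHn ?muln0 //; lia.
Qed.

Lemma derangements_n0 n : 0 < n -> derangements n 0 = 0.
Proof.
case: n => // n _; apply: eq_card0 => s; rewrite !inE cards_eq0.
by apply/negP=> /andP[/eqP/setP/(_ (porbit s ord0))]; rewrite inE imset_f.
Qed.

Lemma derangements00 : derangements 0 0 = 1.
Proof.
rewrite -[RHS](cards1 (1%g : 'S_0)); apply: eq_card => s; rewrite !inE.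
rewrite (_ : s = 1%g) ?eqxx ?card_porbits_ord0; last by apply/permP=> -[].
by apply/forallP=> -[].
Qed.

Lemma marked_countE n k : k <= n -> marked_count n (n - k) = derangements (n + k) k.
Proof.
elim: n k => [|n IHn] [|k] le_kn //.
- by rewrite derangements00 /marked_count big_seq1.
- by rewrite marked_count_small // derangements_n0 // addn0.
rewrite ltnS in le_kn; rewrite subSS addSn addnS derangementsS -IHn //.
(* If $k=n$, no edge is marked, and the term with $n+1$ cycles on $2n+1$ points vanishes. *)
have [->|neq_kn] := eqVneq k n.
  rewrite subnn marked_countS0 derangements_small; last by lia.
  by rewrite add0n addnn.
have lt_kn : k < n by rewrite ltn_neqAle neq_kn.
(* With $n-k=d+1$ the factor $2n-d$ equals $n+k+1$. *)
rewrite -addnS -IHn // subnS; case: (n - k) (subnKC le_kn) => [|d] eq_n; first lia.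
by rewrite marked_countSS; congr (_ * _); lia.
Qed.

(** * Marked trees *)

Definition subsets_of_card (K : choiceType) (A : {fset K}) (j : nat) : {fset {fset K}} :=
  [fset X in fpowerset A | #|` X| == j]%fset.

(** Subsets of [A] are transferred to sets over the finite type of its elements, where [card_draws]
    counts them. *)
Lemma card_subsets_of_card (K : choiceType) (A : {fset K}) (j : nat) :
  #|` subsets_of_card A j| = 'C(#|` A|, j).
Proof.
pose f (Y : {set A}) := [fsetval y in Y]%fset.
have -> : subsets_of_card A j = [fset f Y | Y in [set Y : {set A} | #|Y| == j]%SET]%fset.
  apply/fsetP=> X; rewrite !inE fpowersetE.
  apply/andP/imfsetP=> [[sXA cX]|[Y /= + ->]].
    by exists (fsub A X); rewrite /= ?inE ?card_fsub // /f fsubK.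
  rewrite inE => cY; have sYA : (f Y `<=` A)%fset.
    by apply/fsubsetP=> y /imfsetP[x _ ->]; apply: valP.
  by rewrite sYA -(card_fsub sYA) FSetK.
rewrite card_imfset; last exact: can_inj (@FSetK _ A).
by rewrite cardfE -card_draws cardE.
Qed.

Lemma card_fset_seq (K : choiceType) (s : seq K) :
  uniq s -> #|` [fset x in s]%fset| = size s.
Proof.
move=> uniq_s; rewrite -[in RHS](undup_id uniq_s) -(size_seq_fset tt).
by congr #|` _|; apply/fsetP=> x; rewrite seq_fsetE !inE.
Qed.

Lemma increasing_tree_edges_uniq n t : increasing_tree n t -> uniq (edges t).
Proof. by move=> [lab _]; rewrite uniq_edges // (perm_uniq lab) iota_uniq. Qed.

Definition markable_edges (t : tree) : {fset edge} :=
  [fset e in [seq e <- edges t | markable e]]%fset.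

Lemma card_markable_edges n t : increasing_tree n t -> #|` markable_edges t| = nmark t.
Proof.
move=> tP; rewrite card_fset_seq ?size_filter //.
by rewrite filter_uniq ?(increasing_tree_edges_uniq tP).
Qed.

Definition marked_trees (n j : nat) : seq marked_tree :=
  [seq (t, X) | t <- increasing_trees n, X <- subsets_of_card (markable_edges t) j].

Lemma mem_marked_trees n j T : T \in marked_trees n j <-> edge_marked_trees n j T.
Proof.
case: T => t X; rewrite /edge_marked_trees /edge_marked_tree /marked_edges /=.
split=> [/allpairsPdep[u [Y [/mem_increasing_trees uP + [-> ->]]]]|[[tP XP] cX]].
  rewrite !inE fpowersetE => /andP[/fsubsetP sX /eqP cX]; do 2?split=> //.
  by move=> e /sX; rewrite !inE mem_filter => /andP[/eqP].
apply/allpairsPdep; exists t, X; split=> //; first exact/mem_increasing_trees.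
rewrite !inE fpowersetE cX eqxx andbT; apply/fsubsetP=> e /XP[e_in /eqP Le].
by rewrite !inE mem_filter e_in andbT.
Qed.

Lemma marked_trees_uniq n j : uniq (marked_trees n j).
Proof.
apply: allpairs_uniq_dep; first exact: increasing_trees_uniq.
  by move=> t _; apply: fset_uniq.
by move=> [t X] [u Y] _ _ /= [-> ->].
Qed.

Lemma size_marked_trees n j : size (marked_trees n j) = marked_count n j.
Proof.
rewrite size_allpairs_dep sumnE big_map; apply: eq_big_seq => t tP.
by rewrite card_subsets_of_card (card_markable_edges ((mem_increasing_trees n t).1 tP)).
Qed.

Local Open Scope fset_scope.
Local Open Scope classical_set_scope.
Local Open Scope card_scope.

Theorem proposition4p3 (n k : nat) :
  k <= n ->
  edge_marked_trees n (n - k) #= `I_(stirling_cycle2 n k) /\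
  (0 < n -> forall T : marked_tree, edge_marked_trees n (n - k) T ->
     #|` unmarked_edges T|.+1 = k).
Proof.
move=> le_kn; split.
  have -> : edge_marked_trees n (n - k) = [set` [fset T in marked_trees n (n - k)]].
    apply/seteqP; split=> T /=; rewrite !inE => T_in; exact/mem_marked_trees.
  apply/card_eq_fsetP; rewrite card_fset_seq ?marked_trees_uniq //.
  by rewrite size_marked_trees marked_countE // stirling_cycle2E.
move=> n_gt0 T [[tP XP] cX]; set E := [fset e in edges T.1].
have sXE : (T.2 `<=` E)%fset by apply/fsubsetP=> e /XP[e_in _]; rewrite !inE.
have cE : #|` E| = n.-1.
  by rewrite card_fset_seq ?(size_edges tP) ?(increasing_tree_edges_uniq tP).
(* The inclusion gives $n-k\le n-1$, which excludes $k=0$; then $(n-1)-(n-k)=k-1$ holds without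
   truncation. *)
have := fsubset_leq_card sXE; rewrite /unmarked_edges cardfsDS // cE.
by rewrite -/(marked_edges T) cX; lia.
Qed.
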